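(* Let $p\geq1$ and let $\mathfrak{h}_{2p+1}$ be the Lie algebra of the $(2p+1)$-dimensional Heisenberg group $\mathbb{H}_{2p+1}$, with basis $\{X_1,\dots,X_{2p+1}\}$ whose non-zero brackets are $[X_1,X_2]=[X_3,X_4]=\cdots=[X_{2p-1},X_{2p}]=X_{2p+1}$. The symmetric spaces $\mathbb{H}_{2p+1}/H$ corresponding to the $\mathbb{Z}_2$-gradings $\mathfrak{h}_{2p+1}=\mathfrak{g}_0\oplus\mathfrak{g}_1$ given by - $\mathfrak{h}_{2p+1}=\mathbb{R}\{X_1,X_3,\dots,X_{2p-1}\}\oplus\mathbb{R}\{X_2,X_4,\dots,X_{2p},X_{2p+1}\}$, - $\mathfrak{h}_{2p+1}=\mathbb{R}\{X_2,X_4,\dots,X_{2p}\}\oplus\mathbb{R}\{X_1,X_3,\dots,X_{2p-1},X_{2p+1}\}$ are not pseudo-Riemannian symmetric spaces.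
   Context: In each grading the first summand is $\mathfrak{g}_0$ and the second is $\mathfrak{g}_1$; $H$ is the connected Lie subgroup of $\mathbb{H}_{2p+1}$ with Lie algebra $\mathfrak{g}_0$. The symmetric space $\mathbb{H}_{2p+1}/H$ is a pseudo-Riemannian symmetric space if it carries an $\mathbb{H}_{2p+1}$-invariant pseudo-Riemannian metric; such metrics correspond to non-degenerate symmetric bilinear forms $B$ on $\mathfrak{g}_1$ that are $\mathrm{ad}(\mathfrak{g}_0)$-invariant, i.e. $B([Z,X],Y)+B(X,[Z,Y])=0$ for all $X,Y\in\mathfrak{g}_1$, $Z\in\mathfrak{g}_0$. *)

(* Defs.v *)
From HB Require Import structures.
From mathcomp Require Import all_boot all_order all_algebra.
From mathcomp Require Import all_classical all_reals all_analysis.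
Set Implicit Arguments.
Unset Strict Implicit.
Unset Printing Implicit Defensive.
Import Order.TTheory GRing.Theory Num.Theory.
Import numFieldNormedType.Exports.
Local Open Scope classical_set_scope.
Local Open Scope ring_scope.

Notation heis R p := 'rV[R]_(p.*2.+1).

(* The basis vector X_k for 1 <= k <= 2p+1; k is 1-based. *)
Definition heisX (R : realType) (p k : nat) : heis R p :=
  delta_mx 0 (inord k.-1).

(* The coordinate of x along X_k, with the same 1-based convention. *)
Definition heis_coord (R : realType) (p : nat) (x : heis R p) (k : nat) : R :=
  x 0 (inord k.-1).

(* The bilinear alternating extension of
   [X_1, X_2] = [X_3, X_4] = ... = [X_(2p-1), X_2p] = X_(2p+1). *)
Definition heis_bracket (R : realType) (p : nat) (x y : heis R p) : heis R p :=
  (\sum_(i < p) (heis_coord x i.*2.+1 * heis_coord y i.*2.+2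
               - heis_coord x i.*2.+2 * heis_coord y i.*2.+1))
    *: heisX R p p.*2.+1.

Record Z2grading (R : realType) (p : nat) := Z2Grading {
  gr0 : {vspace heis R p};
  gr1 : {vspace heis R p};
  gr_sum : (gr0 + gr1 = fullv)%VS;
  gr_cap : (gr0 :&: gr1 = 0)%VS;
  gr_bracket00 : forall x y,
    x \in gr0 -> y \in gr0 -> heis_bracket x y \in gr0;
  gr_bracket01 : forall x y,
    x \in gr0 -> y \in gr1 -> heis_bracket x y \in gr1;
  gr_bracket11 : forall x y,
    x \in gr1 -> y \in gr1 -> heis_bracket x y \in gr0 }.

(* The Heisenberg group in exponential coordinates: its underlying manifold is
   its Lie algebra, exp is the identity, and the Baker-Campbell-Hausdorff
   series stops after the first bracket because the algebra is 2-step
   nilpotent. The unit is 0 and the inverse of x is - x. *)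
Definition heis_mul (R : realType) (p : nat) (x y : heis R p) : heis R p :=
  x + y + 2^-1 *: heis_bracket x y.

(* The connected Lie subgroup with Lie algebra g is the subgroup generated by
   exp g, that is, by g itself in exponential coordinates. *)
Definition connected_subgroup (R : realType) (p : nat)
    (g : {vspace heis R p}) : set (heis R p) :=
  [set x | forall S : set (heis R p),
     S 0 ->
     (forall y z, S y -> S z -> S (heis_mul y z)) ->
     (forall y, S y -> S (- y)) ->
     (forall y, y \in g -> S y) ->
     S x].

Fixpoint Ck (R : realType) (V W : normedModType R) (k : nat) (f : V -> W)
    : Prop :=
  if k is k'.+1 then
    (forall x, differentiable f x) /\
    (forall v : V, Ck k' (fun x => 'D_v f x))
  else continuous f.

Definition smooth (R : realType) (V W : normedModType R) (f : V -> W) : Prop :=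
  forall k, Ck k f.

(* The homogeneous space of left cosets x H as a smooth manifold, in a global
   chart: phi is the quotient map read in the chart, a surjective submersion
   onto R^m with fibers the left cosets (this determines the manifold structure
   of the quotient), and tau a is left translation by a. A global chart is no
   restriction here: the quotient of the simply connected nilpotent Heisenberg
   group by a connected Lie subgroup is diffeomorphic to some R^m. *)
Record coset_chart (R : realType) (p m : nat) (H : set (heis R p))
    (phi : heis R p -> 'rV[R]_m) (tau : heis R p -> 'rV[R]_m -> 'rV[R]_m)
    : Prop := CosetChart {
  chart_smooth : smooth phi;
  chart_onto : forall y, exists x, phi x = y;
  chart_submersion : forall x w, exists v, 'd phi x v = w;
  chart_fiber : forall x y,
    phi x = phi y <-> exists2 h, H h & y = heis_mul x h;
  translation_smooth : forall a, smooth (tau a);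
  translationE : forall a x, tau a (phi x) = phi (heis_mul a x) }.

(* The matrix q y is the Gram matrix of the metric on the tangent space at y in
   the standard frame of R^m; its signature is constant by connectedness. *)
Record pseudo_riemannian_metric (R : realType) (m : nat)
    (q : 'rV[R]_m -> 'M[R]_m) : Prop := PseudoRiemannianMetric {
  metric_smooth : smooth q;
  metric_sym : forall y, (q y)^T = q y;
  metric_nondegenerate : forall y, q y \in unitmx }.

Definition metric_form (R : realType) (m : nat) (q : 'rV[R]_m -> 'M[R]_m)
    (y u v : 'rV[R]_m) : R := (u *m q y *m v^T) 0 0.

Definition isometric (R : realType) (m : nat) (q : 'rV[R]_m -> 'M[R]_m)
    (f : 'rV[R]_m -> 'rV[R]_m) : Prop :=
  forall y u v,
    metric_form q (f y) ('d f y u) ('d f y v) = metric_form q y u v.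

Definition pseudo_riemannian_symmetric_space (R : realType) (p : nat)
    (gr : Z2grading R p) : Prop :=
  exists (m : nat) (phi : heis R p -> 'rV[R]_m)
         (tau : heis R p -> 'rV[R]_m -> 'rV[R]_m) (q : 'rV[R]_m -> 'M[R]_m),
    [/\ coset_chart (connected_subgroup (gr0 gr)) phi tau,
        pseudo_riemannian_metric q &
        forall a, isometric q (tau a)].

Definition span_odd (R : realType) (p : nat) : {vspace heis R p} :=
  (\sum_(i < p) <[heisX R p i.*2.+1]>)%VS.

Definition span_even (R : realType) (p : nat) : {vspace heis R p} :=
  (\sum_(i < p) <[heisX R p i.*2.+2]>)%VS.

Definition heis_center (R : realType) (p : nat) : {vspace heis R p} :=
  <[heisX R p p.*2.+1]>%VS.

Section Gradings.
Variables (R : realType) (p : nat).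
Implicit Types x y : heis R p.
Local Notation X := (heisX R p).

Local Lemma coordX j k : (0 < j <= p.*2.+1)%N -> (0 < k <= p.*2.+1)%N ->
  heis_coord (X j) k = (j == k)%:R.
Proof.
move=> /andP[j0 jp] /andP[k0 kp]; rewrite /heis_coord mxE eqxx /=.
by rewrite -val_eqE /= !inordK ?prednK// eq_sym -eqSS !prednK.
Qed.

Local Lemma coord_eq0 x : (forall k, (0 < k <= p.*2.+1)%N -> heis_coord x k = 0) ->
  x = 0.
Proof.
move=> x0; apply/rowP => k; rewrite mxE.
by have := x0 k.+1; rewrite /heis_coord/= inord_val; apply; rewrite ltn_ord.
Qed.

Local Lemma coordD x y k : heis_coord (x + y) k = heis_coord x k + heis_coord y k.
Proof. by rewrite /heis_coord mxE. Qed.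

Local Lemma coordZ a x k : heis_coord (a *: x) k = a * heis_coord x k.
Proof. by rewrite /heis_coord mxE. Qed.

Local Lemma coord_sum (f : 'I_p -> heis R p) k :
  heis_coord (\sum_i f i) k = \sum_i heis_coord (f i) k.
Proof. by rewrite /heis_coord summxE. Qed.

Local Lemma odd_bound (i : 'I_p) : (0 < i.*2.+1 <= p.*2.+1)%N.
Proof. by rewrite /= ltnS leq_double ltnW. Qed.

Local Lemma even_bound (i : 'I_p) : (0 < i.*2.+2 <= p.*2.+1)%N.
Proof. by rewrite /= -doubleS (leq_trans _ (leqnSn _))// leq_double. Qed.

#[local] Hint Resolve odd_bound even_bound : core.

Local Lemma span_odd_coord x k : x \in span_odd R p -> (0 < k <= p.*2.+1)%N ->
  ~~ odd k || (k == p.*2.+1) -> heis_coord x k = 0.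
Proof.
case/memv_sumP => f fP -> kp kn; rewrite coord_sum big1// => i _.
have /vlineP[a ->] := fP i isT; rewrite coordZ coordX//.
case: (i.*2.+1 =P k) kn => [<-|]; last by rewrite mulr0.
by rewrite /= odd_double/= eqSS (inj_eq double_inj) ltn_eqF.
Qed.

Local Lemma span_even_coord x k : x \in span_even R p -> (0 < k <= p.*2.+1)%N ->
  odd k -> heis_coord x k = 0.
Proof.
case/memv_sumP => f fP -> kp kn; rewrite coord_sum big1// => i _.
have /vlineP[a ->] := fP i isT; rewrite coordZ coordX//.
case: (i.*2.+2 =P k) kn => [<-|]; last by rewrite mulr0.
by rewrite /= odd_double.
Qed.

Local Lemma center_coord x k : x \in heis_center R p -> (0 < k <= p.*2.+1)%N ->
  k != p.*2.+1 -> heis_coord x k = 0.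
Proof.
case/vlineP => a -> kp kn; rewrite coordZ coordX ?leqnn//.
by rewrite eq_sym (negPf kn) mulr0.
Qed.

Local Lemma bracket_center x y : heis_bracket x y \in heis_center R p.
Proof. exact/memvZ/memv_line. Qed.

Local Lemma bracket_odd x y : x \in span_odd R p -> y \in span_odd R p ->
  heis_bracket x y = 0.
Proof.
move=> xo yo; rewrite /heis_bracket big1 ?scale0r// => i _.
by rewrite (span_odd_coord xo (even_bound i)) ?(span_odd_coord yo (even_bound i))
  /= ?odd_double// mulr0 mul0r subr0.
Qed.

Local Lemma bracket_evenc x y : x \in (span_even R p + heis_center R p)%VS ->
  y \in (span_even R p + heis_center R p)%VS -> heis_bracket x y = 0.
Proof.
have ev z i : z \in (span_even R p + heis_center R p)%VS ->
    (i < p)%N -> heis_coord z i.*2.+1 = 0.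
  case/memv_addP => u ue [v vc ->] ip.
  have ib := odd_bound (Ordinal ip).
  rewrite coordD (span_even_coord ue ib) /= ?odd_double// add0r.
  by rewrite (center_coord vc ib)// eqSS (inj_eq double_inj) ltn_eqF.
move=> xe ye; rewrite /heis_bracket big1 ?scale0r// => i _.
by rewrite (ev x)// (ev y)// mulr0 mul0r subr0.
Qed.

Local Lemma bracket_oddc x y : x \in (span_odd R p + heis_center R p)%VS ->
  y \in (span_odd R p + heis_center R p)%VS -> heis_bracket x y = 0.
Proof.
have od z i : z \in (span_odd R p + heis_center R p)%VS ->
    (i < p)%N -> heis_coord z i.*2.+2 = 0.
  case/memv_addP => u ue [v vc ->] ip.
  have ib := even_bound (Ordinal ip).
  rewrite coordD (span_odd_coord ue ib) /= ?odd_double// add0r.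
  rewrite (center_coord vc ib)// eqSS; apply/eqP => /(congr1 odd).
  by rewrite /= !odd_double.
move=> xe ye; rewrite /heis_bracket big1 ?scale0r// => i _.
by rewrite (od x)// (od y)// mulr0 mul0r subr0.
Qed.

Local Lemma bracket_even x y : x \in span_even R p -> y \in span_even R p ->
  heis_bracket x y = 0.
Proof.
by move=> xe ye; apply: bracket_evenc; rewrite (subvP (addvSl _ _)).
Qed.

Local Lemma sum_full : (span_odd R p + span_even R p + heis_center R p = fullv)%VS.
Proof.
apply/eqP; rewrite eqEsubv subvf/=; apply/subvP => x _.
rewrite [x]row_sum_delta; apply: memv_suml => k _; apply: memvZ.
have -> : delta_mx 0 k = X k.+1 :> heis R p by rewrite /heisX/= inord_val.
case: (ltnP k p.*2) => [kp|pk]; last first.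
  have -> : k.+1 = p.*2.+1 by apply/eqP; rewrite eqn_leq ltn_ord.
  by rewrite (subvP (addvSr _ _))// memv_line.
rewrite (subvP (addvSl _ _))//.
have kp2 : (k./2 < p)%N.
  rewrite -ltn_double (leq_ltn_trans _ kp)//.
  by rewrite -{2}(odd_double_half k) leq_addl.
rewrite -(odd_double_half k); case: (odd k) => /=.
  by rewrite (subvP (addvSr _ _))// (subvP (sumv_sup (Ordinal kp2) _ (subvv _)))//
    memv_line.
by rewrite (subvP (addvSl _ _))// (subvP (sumv_sup (Ordinal kp2) _ (subvv _)))//
    memv_line.
Qed.

Local Lemma cap_odd_evenc :
  (span_odd R p :&: (span_even R p + heis_center R p) = 0)%VS.
Proof.
apply/eqP; rewrite -subv0; apply/subvP => x; rewrite memv_cap memv0.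
case/andP => xo /memv_addP[u ue [v vc xE]]; apply/eqP/coord_eq0 => k kp.
have [kn|] := boolP (~~ odd k || (k == p.*2.+1)).
  exact: span_odd_coord xo kp kn.
rewrite negb_or negbK => /andP[ko kn].
by rewrite xE coordD (span_even_coord ue)// (center_coord vc)// addr0.
Qed.

Local Lemma cap_even_oddc :
  (span_even R p :&: (span_odd R p + heis_center R p) = 0)%VS.
Proof.
apply/eqP; rewrite -subv0; apply/subvP => x; rewrite memv_cap memv0.
case/andP => xe /memv_addP[u uo [v vc xE]]; apply/eqP/coord_eq0 => k kp.
have [ko|ke] := boolP (odd k); first exact: span_even_coord xe kp ko.
rewrite xE coordD (span_odd_coord uo)// ?ke// (center_coord vc)// ?addr0//.
by apply: contraNneq ke => ->; rewrite /= odd_double.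
Qed.

Lemma odd_sum : (span_odd R p + (span_even R p + heis_center R p) = fullv)%VS.
Proof. by rewrite addvA sum_full. Qed.

Lemma even_sum :
  (span_even R p + (span_odd R p + heis_center R p) = fullv)%VS.
Proof. by rewrite addvA (addvC (span_even R p)) sum_full. Qed.

Lemma bracket_mem_addc (U : {vspace heis R p}) x y :
  heis_bracket x y \in (U + heis_center R p)%VS.
Proof. by rewrite (subvP (addvSr _ _))// bracket_center. Qed.

Lemma odd_bracket00 x y : x \in span_odd R p -> y \in span_odd R p ->
  heis_bracket x y \in span_odd R p.
Proof. by move=> xo yo; rewrite bracket_odd// mem0v. Qed.

Lemma even_bracket00 x y : x \in span_even R p -> y \in span_even R p ->
  heis_bracket x y \in span_even R p.
Proof. by move=> xe ye; rewrite bracket_even// mem0v. Qed.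

Lemma odd_bracket11 x y : x \in (span_even R p + heis_center R p)%VS ->
  y \in (span_even R p + heis_center R p)%VS ->
  heis_bracket x y \in span_odd R p.
Proof. by move=> xe ye; rewrite bracket_evenc// mem0v. Qed.

Lemma even_bracket11 x y : x \in (span_odd R p + heis_center R p)%VS ->
  y \in (span_odd R p + heis_center R p)%VS ->
  heis_bracket x y \in span_even R p.
Proof. by move=> xo yo; rewrite bracket_oddc// mem0v. Qed.

Definition grading_odd : Z2grading R p :=
  {| gr0 := span_odd R p;
     gr1 := (span_even R p + heis_center R p)%VS;
     gr_sum := odd_sum;
     gr_cap := cap_odd_evenc;
     gr_bracket00 := odd_bracket00;
     gr_bracket01 := fun x y _ _ => bracket_mem_addc (span_even R p) x y;
     gr_bracket11 := odd_bracket11 |}.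

Definition grading_even : Z2grading R p :=
  {| gr0 := span_even R p;
     gr1 := (span_odd R p + heis_center R p)%VS;
     gr_sum := even_sum;
     gr_cap := cap_even_oddc;
     gr_bracket00 := even_bracket00;
     gr_bracket01 := fun x y _ _ => bracket_mem_addc (span_odd R p) x y;
     gr_bracket11 := even_bracket11 |}.

End Gradings.

(* Main.v *)
Require Import Defs.
From mathcomp Require Import all_boot all_order all_algebra.
From mathcomp Require Import all_classical all_reals all_analysis.
From mathcomp Require Import ring lra.
Set Implicit Arguments.
Unset Strict Implicit.
Unset Printing Implicit Defensive.
Import Order.TTheory GRing.Theory Num.Theory.
Import numFieldNormedType.Exports.
Local Open Scope classical_set_scope.
Local Open Scope ring_scope.

(** Suppose that [h] lies in [gr0] and that the central vector [z = [h, w]]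
does not. Pull the metric at the base point back by the differential [T] of the
quotient map at the unit, to get a symmetric form [B] on the Lie algebra.

Left translation by [h] fixes the base point, and there its differential is
[Ad h], that is, [T v |-> T (v + [h, v])] ([isotropy_diff]). So [B] is invariant
under [v |-> v + [h, v]]. Applied to a vector and [z], invariance gives
[B [h, v] z = 0]; applied to [w] twice it gives [2 B w z = 0]; applied to any
[u] and [w] it then gives [B u z = 0], because [[h, u]] is a multiple of [z].
The metric being nondegenerate and [T] surjective, [T z = 0].

This is impossible ([bracket_tangent_neq0]): as [z] is central, the quotient
map along the line [R z] is moved by translations, so its derivative there would
vanish everywhere and [z] would lie in the stabilizer, which is [gr0] itself in
exponential coordinates.

Both gradings fall under this argument ([not_pseudo_riemannian_of_bracket]),
with [h = X_1, w = X_2] and [h = X_2, w = X_1]: the center lies in [gr1], hence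
meets [gr0] trivially. *)

(** * The Heisenberg bracket *)

Section Heisenberg.
Context {R : realType} {p : nat}.
Implicit Types x y z v w : heis R p.
Local Notation Z := (heisX R p p.*2.+1).

Definition heis_form x y : R :=
  \sum_(i < p) (heis_coord x i.*2.+1 * heis_coord y i.*2.+2
              - heis_coord x i.*2.+2 * heis_coord y i.*2.+1).

Lemma heis_bracketE x y : heis_bracket x y = heis_form x y *: Z.
Proof. by []. Qed.

Lemma heis_formD x y z : heis_form x (y + z) = heis_form x y + heis_form x z.
Proof.
rewrite /heis_form -big_split; apply: eq_bigr => i _.
by rewrite /heis_coord !mxE /=; ring.
Qed.

Lemma heis_formZ a x y : heis_form x (a *: y) = a * heis_form x y.
Proof.
rewrite /heis_form mulr_sumr; apply: eq_bigr => i _.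
by rewrite /heis_coord !mxE /=; ring.
Qed.

Lemma heis_formC x y : heis_form x y = - heis_form y x.
Proof.
by rewrite /heis_form -sumrN; apply: eq_bigr => i _; ring.
Qed.

Lemma heis_formZZ x : heis_form x Z = 0.
Proof.
rewrite /heis_form big1// => i _.
rewrite /heis_coord !mxE /= -!val_eqE /= !inordK ?ltnS //.
- have ip := ltn_ord i.
  have -> : (i.*2.+1 == p.*2) = false.
    by apply/negbTE/eqP => /(congr1 odd); rewrite /= !odd_double.
  have -> : (i.*2 == p.*2) = false by rewrite (inj_eq double_inj) ltn_eqF.
  by rewrite !mulr0 subrr.
- by rewrite leq_double ltnW.
- by rewrite ltn_double.
Qed.

Lemma heis_bracketD x y z :
  heis_bracket x (y + z) = heis_bracket x y + heis_bracket x z.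
Proof. by rewrite !heis_bracketE heis_formD scalerDl. Qed.

Lemma heis_bracketZ a x y : heis_bracket x (a *: y) = a *: heis_bracket x y.
Proof. by rewrite !heis_bracketE heis_formZ scalerA. Qed.

Lemma heis_bracketC x y : heis_bracket x y = - heis_bracket y x.
Proof. by rewrite !heis_bracketE heis_formC scaleNr. Qed.

Lemma heis_bracketA x y z : heis_bracket x (heis_bracket y z) = 0.
Proof.
by rewrite !heis_bracketE heis_formZ heis_formZZ mulr0 scale0r.
Qed.

Lemma heis_bracketxx x : heis_bracket x x = 0.
Proof.
apply/eqP; have := heis_bracketC x x.
by move/eqP; rewrite -addr_eq0 -mulr2n -scaler_nat scaler_eq0 pnatr_eq0.
Qed.

(** The series of [exp (ad h)] stops after its linear term, brackets being
central. *)
Lemma heis_conj h x :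
  heis_mul (heis_mul h x) (- h) = x + heis_bracket h x.
Proof.
rewrite /heis_mul -[- h]scaleN1r heis_bracketZ (heis_bracketC _ h).
rewrite !heis_bracketD heis_bracketZ heis_bracketA heis_bracketxx scaler0.
rewrite addr0 add0r !scaleN1r opprK.
apply/rowP => k; rewrite !mxE /=; lra.
Qed.

(** A subalgebra is already a subgroup in exponential coordinates, since the
group law only involves sums, scalings and brackets. *)
Lemma connected_subgroup_sub (g : {vspace heis R p}) x :
  (forall y z, y \in g -> z \in g -> heis_bracket y z \in g) ->
  connected_subgroup g x -> x \in g.
Proof.
move=> gb xH; apply: (xH (fun y => y \in g)) => //.
- exact: mem0v.
- move=> y z yg zg; rewrite /heis_mul /=.
  by apply: memvD; [exact: memvD|apply: memvZ; exact: gb].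
- by move=> y; rewrite memvN.
Qed.

Lemma connected_subgroup_sup (g : {vspace heis R p}) x :
  x \in g -> connected_subgroup g x.
Proof. by move=> xg S _ _ _; apply. Qed.

End Heisenberg.

(** * Differentials along lines *)

Lemma smooth_differentiable (R : realType) (V W : normedModType R)
  (f : V -> W) x : smooth f -> differentiable f x.
Proof. by move=> /(_ 1%N)[]. Qed.

(** The mean value theorem, applied to each coordinate of [t |-> f (t *: z)]. *)
Lemma diff_along (R : realType) (V : normedModType R) (m : nat)
    (f : V -> 'rV[R]_m) (z : V) :
  (forall t : R, differentiable f (t *: z)) ->
  (forall t : R, 'd f (t *: z) z = 0) -> f z = f 0.
Proof.
move=> df df0; apply/rowP => j.
pose g := (fun N : 'rV[R]_m => N 0 j : R) \o (f \o (fun t : R => t *: z)).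
suff gd t : is_derive t (1 : R) g 0.
  by have := is_derive_0_is_cst 1 0 gd; rewrite /g /= scale1r scale0r.
have dz : differentiable (fun t : R => t *: z) t by exact: differentiableZl.
have dfz : differentiable (f \o (fun t : R => t *: z)) t.
  exact: differentiable_comp.
have dc := differentiable_coord (f (t *: z)) 0 j.
have dg : differentiable g t by exact: differentiable_comp.
apply: DeriveDef; first exact: diff_derivable.
rewrite deriveE// /g diff_comp//= diff_comp//= diffZl// diff_val/=.
by rewrite scale1r df0 linear0.
Qed.

(** Differentials are read off lines, so identities between maps that hold on a
line can be differentiated without the differential of the affine changes of
variable involved. *)
Lemma diff_eq_along (R : realType) (U V W : normedModType R)
    (f : U -> W) (g : V -> W) x y u v :
  differentiable f x -> differentiable g y ->
  (forall t : R, f (t *: u + x) = g (t *: v + y)) -> 'd f x u = 'd g y v.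
Proof.
move=> df dg fg; rewrite -!deriveE// /derive.
have fg0 : f x = g y by have := fg 0; rewrite !scale0r !add0r.
suff -> : (fun t : R => t^-1 *: ((f \o shift x) (t *: u) - f x)) =
          (fun t : R => t^-1 *: ((g \o shift y) (t *: v) - g y)) by [].
by apply/funext => t /=; rewrite fg fg0.
Qed.

(** * The quotient map and the isotropy representation *)

Section Chart.
Context {R : realType} {p m : nat} {g : {vspace heis R p}}
  {phi : heis R p -> 'rV[R]_m} {tau : heis R p -> 'rV[R]_m -> 'rV[R]_m}.
Hypothesis chart : coset_chart (connected_subgroup g) phi tau.

Let dphi x : differentiable phi x.
Proof. exact/smooth_differentiable/chart_smooth/chart. Qed.

Let dtau a y : differentiable (tau a) y.
Proof. exact/smooth_differentiable/(translation_smooth chart). Qed.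

(** The point [h x] may be replaced by [h x h^-1], which lies in the same left
coset. *)
Lemma isotropy_translation h x : h \in g ->
  tau h (phi x) = phi (x + heis_bracket h x).
Proof.
move=> hg; rewrite (translationE chart) -heis_conj.
apply/(chart_fiber chart); exists (- h) => //.
by apply: connected_subgroup_sup; rewrite memvN.
Qed.

(** Under the quotient map, the isotropy representation is the adjoint action. *)
Lemma isotropy_diff h v : h \in g ->
  'd (tau h) (phi 0) ('d phi 0 v) = 'd phi 0 (v + heis_bracket h v).
Proof.
move=> hg; have /(congr1 (fun f => f v)) /= <- := diff_comp (dphi 0) (dtau h _).
apply: diff_eq_along => // [|t]; first exact: differentiable_comp.
by rewrite /= !addr0 isotropy_translation// heis_bracketZ scalerDr.
Qed.

Lemma isotropy_translation0 h : h \in g -> tau h (phi 0) = phi 0.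
Proof.
move=> hg; rewrite isotropy_translation// add0r -(scale0r 0) heis_bracketZ.
by rewrite !scale0r.
Qed.

(** The kernel of the differential at the unit contains no bracket outside the
isotropy algebra. If it contained such a [z], then, [z] being central,
[phi (t z + x) = tau (t z) (phi x)] would carry the vanishing of the derivative
in direction [z] from the unit to every point of the line [R z]; the quotient
map would be constant on it, so [z] would be in the coset of the unit. *)
Lemma bracket_tangent_neq0 x y : heis_bracket x y \notin g ->
  (forall u v, u \in g -> v \in g -> heis_bracket u v \in g) ->
  'd phi 0 (heis_bracket x y) != 0.
Proof.
set z := heis_bracket x y => zg gb; apply/eqP => z0.
have ztr a v : phi (a *: z + v) = tau (a *: z) (phi v).
  rewrite (translationE chart) /heis_mul (heis_bracketC _ v) heis_bracketZ.
  by rewrite heis_bracketA scaler0 oppr0 scaler0 addr0.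
have z1 : phi z = phi 0.
  apply: diff_along => [t|t]; first exact: dphi.
  have -> : 'd phi (t *: z) z = 'd (tau (t *: z) \o phi) 0 z.
    apply: diff_eq_along => [||s]; [exact: dphi|exact: differentiable_comp|].
    by rewrite addrC ztr addr0.
  by rewrite diff_comp//= z0 linear0.
move/(chart_fiber chart): (esym z1) => [h hH zE].
move/negP: zg; apply; apply: connected_subgroup_sub gb _.
suff -> : z = h by [].
rewrite zE /heis_mul heis_bracketC -(scale0r 0) heis_bracketZ !scale0r.
by rewrite oppr0 scaler0 addr0 add0r.
Qed.

End Chart.

(** * The metric form *)

Section MetricForm.
Context {R : realType} {m : nat} {q : 'rV[R]_m -> 'M[R]_m}.
Hypothesis metric : pseudo_riemannian_metric q.
Implicit Types y u v w : 'rV[R]_m.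

Lemma metric_formDl y u v w :
  metric_form q y (u + v) w = metric_form q y u w + metric_form q y v w.
Proof. by rewrite /metric_form !mulmxDl mxE. Qed.

Lemma metric_formZl y a u w :
  metric_form q y (a *: u) w = a * metric_form q y u w.
Proof. by rewrite /metric_form -!scalemxAl mxE. Qed.

Lemma metric_formC y u v : metric_form q y u v = metric_form q y v u.
Proof.
rewrite /metric_form -[in LHS](trmxK (_ *m _ *m _)) [LHS]mxE.
by rewrite !trmx_mul trmxK (Defs.metric_sym metric) mulmxA.
Qed.

Lemma metric_form_eq0 y u : (forall v, metric_form q y v u = 0) -> u = 0.
Proof.
move=> u0; suff : u *m q y = 0.
  move/(congr1 (mulmx^~ (invmx (q y)))).
  by rewrite mulmxK ?(metric_nondegenerate metric)// mul0mx.
apply/rowP => j; have := u0 (delta_mx 0 j); rewrite metric_formC.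
by rewrite /metric_form trmx_delta -colE !mxE.
Qed.

End MetricForm.

(** * The obstruction *)

(** The isotropy is unipotent: it shifts [w] by the central vector [z = [h, w]].
Invariance of the form then puts [z] in its radical. *)
Lemma not_pseudo_riemannian_of_bracket (R : realType) (p : nat)
    (gr : Z2grading R p) (h w : heis R p) :
  h \in gr0 gr -> heis_bracket h w \notin gr0 gr ->
  ~ pseudo_riemannian_symmetric_space gr.
Proof.
move=> hg zg [m [phi [tau [q [chart metric inv]]]]].
set z := heis_bracket h w in zg.
pose B u v := metric_form q (phi 0) ('d phi 0 u) ('d phi 0 v).
have BC u v : B u v = B v u by exact: metric_formC.
have BDl u v v' : B (u + v) v' = B u v' + B v v'.
  by rewrite /B linearD metric_formDl.
have BDr u v v' : B v' (u + v) = B v' u + B v' v.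
  by rewrite !(BC v') BDl.
have BZl a u v : B (a *: u) v = a * B u v by rewrite /B linearZ metric_formZl.
have Binv u v : B (u + heis_bracket h u) (v + heis_bracket h v) = B u v.
  rewrite /B -!(isotropy_diff chart)// -[RHS](inv h).
  by rewrite (isotropy_translation0 chart).
(* Invariance on [u] and [z], the latter being fixed by the adjoint action. *)
have BbZ u : B (heis_bracket h u) z = 0.
  by have := Binv u z; rewrite heis_bracketA addr0 BDl; lra.
(* The quadratic form at [w] and [w + z] agrees, and [B z z = 0] by [BbZ]. *)
have Bwz : B w z = 0.
  have := Binv w w; rewrite -/z !BDl !BDr (BC z w) BbZ; lra.
have b0 : heis_form h w != 0.
  by apply: contraNneq zg => b0; rewrite /z heis_bracketE b0 scale0r mem0v.
(* The derived algebra is a line, so [[h, u]] is a multiple [c *: z], and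
   invariance on [u] and [w] reads [B u z + c * B z w = 0]. *)
have Buz u : B u z = 0.
  have cE : heis_bracket h u = (heis_form h u / heis_form h w) *: z.
    by rewrite /z !heis_bracketE scalerA divfK.
  have := Binv u w; rewrite -/z BDl !BDr BbZ cE BZl (BC z) Bwz; lra.
have /eqP[] := bracket_tangent_neq0 chart zg (@gr_bracket00 _ _ gr).
apply: (metric_form_eq0 metric) => v.
by have [u <-] := chart_submersion chart 0 v; exact: Buz.
Qed.

(** * The two gradings *)

Lemma heis_bracket_basis (R : realType) (p : nat) (i : 'I_p) :
  heis_bracket (heisX R p i.*2.+1) (heisX R p i.*2.+2) = heisX R p p.*2.+1.
Proof.
have obd (k : 'I_p) : (0 < k.*2.+1 <= p.*2.+1)%N.
  by rewrite /= ltnS leq_double ltnW.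
have ebd (k : 'I_p) : (0 < k.*2.+2 <= p.*2.+1)%N.
  by rewrite /= ltnS ltn_double.
rewrite heis_bracketE -[RHS]scale1r; congr (_ *: _).
rewrite /heis_form (bigD1 i)//= big1 => [|k ki].
  rewrite !Defs.coordX// !eqxx mulr1.
  by rewrite [_ == i.*2.+2]ltn_eqF// mul0r subr0 addr0.
rewrite !Defs.coordX// !eqSS !(inj_eq double_inj).
rewrite [i == k :> nat]eq_sym (negPf (ki : k != i :> nat)) mul0r.
have -> : (i.*2 == k.*2.+1) = false.
  by apply/negbTE/eqP => /(congr1 odd); rewrite /= !odd_double.
by rewrite mul0r subrr.
Qed.

Lemma heis_center_notin0 (R : realType) (p : nat) (gr : Z2grading R p) :
  (heis_center R p <= gr1 gr)%VS -> heisX R p p.*2.+1 \notin gr0 gr.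
Proof.
move=> /subvP c1; apply/negP => c0.
have : heisX R p p.*2.+1 \in (gr0 gr :&: gr1 gr)%VS.
  by rewrite memv_cap c0 c1 ?memv_line.
rewrite gr_cap memv0 => /eqP /rowP /(_ (inord p.*2)).
by rewrite !mxE !eqxx; apply/eqP/oner_neq0.
Qed.

Theorem proposition25 (R : realType) (p : nat) (hp : (1 <= p)%N) :
  ~ pseudo_riemannian_symmetric_space (grading_odd R p) /\
  ~ pseudo_riemannian_symmetric_space (grading_even R p).
Proof.
have X12 := heis_bracket_basis R (Ordinal hp).
split.
- apply: (@not_pseudo_riemannian_of_bracket _ _ _ (heisX R p 1) (heisX R p 2)).
    exact: (subvP (sumv_sup (Ordinal hp) _ (subvv _))) (memv_line _).
  by rewrite [heis_bracket _ _]X12 heis_center_notin0 ?addvSr.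
- apply: (@not_pseudo_riemannian_of_bracket _ _ _ (heisX R p 2) (heisX R p 1)).
    exact: (subvP (sumv_sup (Ordinal hp) _ (subvv _))) (memv_line _).
  by rewrite heis_bracketC [heis_bracket _ _]X12 memvN heis_center_notin0 ?addvSr.
Qed.
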